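(* Let $I=(U,R)$ be an approximation space (a non-empty finite set $U$ with an equivalence relation $R$ on $U$), and let $(T,\Delta,\nabla)$ be its rough semiring. Then the dual pseudocomplemented rough semiring $(T,\Delta,\nabla,{}^{+},RS(\emptyset),RS(U))$ is a dual rough Stone algebra, i.e. $RS(X)^{+}\,\nabla\, RS(X)^{++}=RS(\emptyset)$ for all $RS(X)\in T$.
   Context: Setting. $U$ is a non-empty finite set, $R$ an equivalence relation on $U$, $[x]_R$ the class of $x$. For $X\subseteq U$ put $R_{-}(X)=\{x\in U: [x]_R\subseteq X\}$, $R^{-}(X)=\{x\in U: [x]_R\cap X\neq\emptyset\}$. The rough set of $X$ is $RS(X)=(R_{-}(X),R^{-}(X))$, and $T=\{RS(X): X\subseteq U\}$. $T$ is ordered componentwise: $RS(X)\le RS(Y)$ iff $R_{-}(X)\subseteq R_{-}(Y)$ and $R^{-}(X)\subseteq R^{-}(Y)$. Operations on subsets of $U$. Let $IW(X)$ be the number of equivalence classes contained in $X$. Praba join: if $IW(X\cup Y)=IW(X)+IW(Y)-IW(X\cap Y)$ then $X\Delta Y=X\cup Y$. If $IW(X\cup Y)>IW(X)+IW(Y)-IW(X\cap Y)$, one identifies an equivalence class newly formed by the union (contained in $X\cup Y$ but in neither $X$ nor $Y$), deletes from $Y$ its elements belonging to that class, calls the result $Y$ again, and repeats until equality holds; then $X\Delta Y$ is the union of $X$ and the final $Y$. Praba meet: $x$ is a pivot element of $X,Y$ if $[x]_R\not\subseteq X\cap Y$, $[x]_R\cap X\ne\emptyset$ and $[x]_R\cap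 Y\neq\emptyset$; the pivot set $P_{X\cap Y}$ consists of one representative pivot element for each such class; $X\nabla Y=\{x\in U:[x]_R\subseteq X\cap Y\}\cup P_{X\cap Y}$. Operations on $T$. $RS(X)\Delta RS(Y)=RS(X\Delta Y)$ and $RS(X)\nabla RS(Y)=RS(X\nabla Y)$; it is known that these are respectively the least upper bound and the greatest lower bound of $RS(X),RS(Y)$ in $T$, and that $(T,\Delta,\nabla)$ is a semiring, called the rough semiring. $RS(\emptyset)$ and $RS(U)$ are the least and greatest elements of $T$. Definitions. The dual pseudocomplement of $RS(X)\in T$ is the least element $RS(X)^{+}$ of $\{RS(Y)\in T: RS(X)\Delta RS(Y)=RS(U)\}$; $RS(X)^{++}$ denotes $(RS(X)^{+})^{+}$. A dual pseudocomplemented rough semiring $(T,\Delta,\nabla,{}^{+},RS(\emptyset),RS(U))$ is a rough semiring in which every element has a dual pseudocomplement. It is called a dual rough Stone algebra if $RS(X)^{+}\nabla RS(X)^{++}=RS(\emptyset)$ for all $RS(X)\in T$. *)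

(* Defs.v *)
From mathcomp Require Import all_boot.

Set Implicit Arguments.
Unset Strict Implicit.
Unset Printing Implicit Defensive.

Section RoughSets.

Variables (U : finType) (R : rel U).
Implicit Types (X Y Z P C : {set U}) (x y : U).

Definition eqclass x : {set U} := [set y | R x y].

Definition eqclasses : {set {set U}} := [set eqclass x | x : U].

Definition lower X : {set U} := [set x | eqclass x \subset X].

Definition upper X : {set U} := [set x | eqclass x :&: X != set0].

Definition rs_pair X : {set U} * {set U} := (lower X, upper X).

(* The carrier T = {RS(X) : X subset of U}, as a finite type. *)
Definition rough : finType := {p : {set U} * {set U} | p \in codom rs_pair}.

Definition RS X : rough := exist _ (rs_pair X) (codom_f rs_pair X).

Definition rough_le (a b : rough) : bool :=
  ((val a).1 \subset (val b).1) && ((val a).2 \subset (val b).2).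

(* A subset of U whose rough set is a; the operations on T below do not depend
   on this choice, see rough_joinE and rough_meetE. *)
Definition rough_repr (a : rough) : {set U} := iinv (valP a).

Definition IW X : nat := #|[set C in eqclasses | C \subset X]|.

Definition new_classes X Y : {set {set U}} :=
  [set C in eqclasses |
    [&& C \subset X :|: Y, ~~ (C \subset X) & ~~ (C \subset Y)]].

(* praba_run X Y Y': the deletion process started from Y, with any choice of a
   new class at each round, may end in Y'. *)
Inductive praba_run X : {set U} -> {set U} -> Prop :=
| praba_stop Y of IW (X :|: Y) = IW X + IW Y - IW (X :&: Y) :
    praba_run X Y Y
| praba_delete Y C Y' of IW X + IW Y - IW (X :&: Y) < IW (X :|: Y)
    & C \in new_classes X Y & praba_run X (Y :\: C) Y' :
    praba_run X Y Y'.

Definition praba_step X Y : {set U} :=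
  if IW X + IW Y - IW (X :&: Y) < IW (X :|: Y) then
    if [pick C in new_classes X Y] is Some C then Y :\: C else Y
  else Y.

(* One run of the process. Each effective step removes an element of Y, so #|U|
   rounds are enough to stop (praba_final_run); the choice of the deleted
   classes does not affect the rough set of the join (rough_joinE). *)
Definition praba_final X Y : {set U} := iter #|U| (praba_step X) Y.

Definition praba_join X Y : {set U} := X :|: praba_final X Y.

(* A pivot need not itself belong to X or to Y. *)
Definition pivot X Y x : bool :=
  [&& ~~ (eqclass x \subset X :&: Y),
      eqclass x :&: X != set0 & eqclass x :&: Y != set0].

Definition is_pivot_set X Y P : bool :=
  [forall x in P, pivot X Y x] &&
  [forall x, pivot X Y x ==> (#|P :&: eqclass x| == 1)].

(* One pivot set, arbitrarily chosen. The default is never used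
   (pivot_setP), and the choice does not affect the rough set of the meet
   (rough_meetE). *)
Definition pivot_set X Y : {set U} :=
  odflt set0 [pick P | is_pivot_set X Y P].

Definition praba_meet X Y : {set U} :=
  [set x | eqclass x \subset X :&: Y] :|: pivot_set X Y.

Definition rough_join (a b : rough) : rough :=
  RS (praba_join (rough_repr a) (rough_repr b)).

Definition rough_meet (a b : rough) : rough :=
  RS (praba_meet (rough_repr a) (rough_repr b)).

Definition is_dual_pc (a b : rough) : bool :=
  (rough_join a b == RS setT) &&
  [forall c, (rough_join a c == RS setT) ==> rough_le b c].

(* The default RS setT is irrelevant for an a that has a dual pseudocomplement:
   the latter is unique by antisymmetry of rough_le. *)
Definition dual_pc (a : rough) : rough :=
  odflt (RS setT) [pick b | is_dual_pc a b].

Definition dual_pseudocomplemented : Prop :=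
  forall a : rough, exists b : rough, is_dual_pc a b.

Definition dual_rough_Stone_algebra : Prop :=
  dual_pseudocomplemented /\
  forall a : rough, rough_meet (dual_pc a) (dual_pc (dual_pc a)) = RS set0.

Lemma rough_repr_RS (a : rough) : RS (rough_repr a) = a.
Proof. by apply: val_inj; rewrite /= /rough_repr f_iinv. Qed.

Lemma rough_le_anti (a b : rough) : rough_le a b -> rough_le b a -> a = b.
Proof.
move=> /andP[l1 u1] /andP[l2 u2]; apply: val_inj.
rewrite [val a]surjective_pairing [val b]surjective_pairing.
by congr pair; apply/eqP; rewrite eqEsubset; apply/andP.
Qed.

Lemma dual_pcP (a b : rough) : is_dual_pc a b -> dual_pc a = b.
Proof.
move=> hb; rewrite /dual_pc; case: pickP => [c hc|/(_ b)]; last by rewrite hb.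
case/andP: hb => b1 /forallP b2; case/andP: hc => c1 /forallP c2 /=.
apply: rough_le_anti; first exact: (implyP (c2 b)).
exact: (implyP (b2 c)).
Qed.

Section Equivalence.

Hypothesis eqR : equivalence_rel R.

Lemma eqclass_refl x : x \in eqclass x.
Proof. by rewrite inE (eqR x x x).1. Qed.

Lemma eqclass_eq x y : y \in eqclass x -> eqclass y = eqclass x.
Proof.
rewrite inE => Rxy; apply/setP => z; rewrite !inE.
by rewrite ((eqR x y z).2 Rxy).
Qed.

Lemma IW_setU X Y :
  IW (X :|: Y) = IW X + IW Y - IW (X :&: Y) + #|new_classes X Y|.
Proof.
pose K Z := [set C in eqclasses | C \subset Z].
have KI : K (X :&: Y) = K X :&: K Y.
  by apply/setP => C; rewrite !inE subsetI; case: (C \in eqclasses).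
have KU : K (X :|: Y) = (K X :|: K Y) :|: new_classes X Y.
  apply/setP => C; rewrite !inE; case: (C \in eqclasses) => //=.
  case: (boolP (C \subset X)) => [h|_] /=; first by rewrite (subset_trans h) ?subsetUl.
  case: (boolP (C \subset Y)) => [h|_] /=; first by rewrite (subset_trans h) ?subsetUr.
  by rewrite andbT.
have D : (K X :|: K Y) :&: new_classes X Y = set0.
  apply/setP => C; rewrite !inE; case: (C \in eqclasses) => //=.
  by case: (C \subset X); case: (C \subset Y); rewrite ?andbF.
by rewrite /IW -!/(K _) KU cardsU D cards0 subn0 KI -cardsU.
Qed.

Lemma praba_final_run X Y : praba_run X Y (praba_final X Y).
Proof.
have: #|Y| <= #|U| by apply: max_card.
rewrite /praba_final; elim: #|U| Y => [|n IHn] Y hY.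
  apply: praba_stop; move: hY; rewrite leqn0 cards_eq0 => /eqP ->.
  by rewrite setU0 setI0 addnK.
rewrite iterSr {2}/praba_step; case: ltnP => lt; last first.
  rewrite (_ : iter n _ _ = Y).
    by apply: praba_stop; apply/eqP; rewrite eqn_leq lt IW_setU leq_addr.
  elim: {IHn hY} n => //= n ->.
  by rewrite /praba_step ltnNge lt.
case: pickP => [C hC|h0]; last first.
  move: lt; rewrite IW_setU (_ : new_classes X Y = set0) ?cards0 ?addn0 ?ltnn //.
  by apply/setP => C; rewrite h0 inE.
apply: (praba_delete lt hC); apply: IHn; rewrite -ltnS; apply: leq_trans hY.
move: hC; rewrite !inE => /and4P[_ CU CX _].
apply: proper_card; rewrite properE subsetDl /=.
case/subsetPn: CX => x xC xX; have := subsetP CU _ xC.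
rewrite inE (negPf xX) /= => xY.
by apply/subsetPn; exists x => //; rewrite inE xC.
Qed.

Lemma upperU X Y : upper (X :|: Y) = upper X :|: upper Y.
Proof. by apply/setP => x; rewrite !inE setIUr setU_eq0 negb_and. Qed.

Lemma praba_delete_approx X Y C : C \in new_classes X Y ->
  lower X :|: lower (Y :\: C) = lower X :|: lower Y /\
  upper X :|: upper (Y :\: C) = upper X :|: upper Y.
Proof.
rewrite inE => /and4P[/imsetP[c _ ->] CU CX CY].
split; apply/setP => x; rewrite !inE.
  congr orb; rewrite subsetD; case: (boolP (_ \subset Y)) => //= xY.
  rewrite -setI_eq0; apply/negPn/negP => /set0Pn[y /setIP[yx yc]].
  by move: CY; rewrite -(eqclass_eq yc) (eqclass_eq yx) xY.
case: (boolP (_ :&: X != _)) => //= xX; apply/idP/idP.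
  by apply: contraNN => /eqP e; rewrite -subset0 -e setIS ?subsetDl.
case/set0Pn=> y /setIP[yx yY]; apply/set0Pn; exists y.
rewrite in_setI in_setD yY yx andbT /=; apply/negP => yc.
have e : eqclass x = eqclass c by rewrite -(eqclass_eq yx) (eqclass_eq yc).
case/subsetPn: CY => z zC zY; move/subsetP/(_ _ zC): CU.
rewrite inE (negPf zY) orbF => zX; move/negP: xX; apply.
by apply/set0Pn; exists z; rewrite inE e zC.
Qed.

Lemma RS_praba_run X Y Y' : praba_run X Y Y' ->
  rs_pair (X :|: Y') = (lower X :|: lower Y, upper X :|: upper Y).
Proof.
elim=> {Y Y'} [Y e|Y C Y' _ hC _ ->]; last first.
  by have [-> ->] := praba_delete_approx hC.
rewrite /rs_pair upperU; congr pair.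
have /eqP : #|new_classes X Y| = 0.
  by apply/eqP; rewrite -(eqn_add2l (IW X + IW Y - IW (X :&: Y))) -IW_setU addn0 e.
rewrite cards_eq0 => /eqP/setP N0.
apply/setP => x; have := N0 (eqclass x); rewrite !inE imset_f //=.
case: (boolP (_ \subset X)) => [h _|_] /=; first by rewrite (subset_trans h) ?subsetUl.
case: (boolP (_ \subset Y)) => [h _|_] /=; first by rewrite (subset_trans h) ?subsetUr.
by rewrite andbT.
Qed.

Lemma pivot_eqclass X Y x y : y \in eqclass x -> pivot X Y y = pivot X Y x.
Proof. by move=> /eqclass_eq; rewrite /pivot => ->. Qed.

Lemma pivot_setP X Y : is_pivot_set X Y (pivot_set X Y).
Proof.
rewrite /pivot_set; case: pickP => //= h0.
pose r x := odflt x [pick y in eqclass x].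
have rP x : r x \in eqclass x.
  by rewrite /r; case: pickP => //= _; apply: eqclass_refl.
have rE x y : y \in eqclass x -> r y = r x.
  move=> yx; rewrite /r (eqclass_eq yx); case: pickP => // /(_ x).
  by rewrite eqclass_refl.
have := h0 [set r x | x in [pred x | pivot X Y x]]; case/negP; apply/andP; split.
  apply/forall_inP => _ /imsetP[x px ->]; rewrite inE in px.
  by rewrite (pivot_eqclass _ _ (rP x)).
apply/forall_inP => x px; apply/cards1P; exists (r x).
apply/setP => y; rewrite !inE; apply/andP/eqP => [[/imsetP[z _ ->] xz]|->].
  have zx : r z \in eqclass x by rewrite inE.
  apply: rE; have <- : eqclass z = eqclass x.
    by rewrite -(eqclass_eq (rP z)) (eqclass_eq zx).
  exact: eqclass_refl.
by split; [apply: imset_f; rewrite inE | have := rP x; rewrite inE].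
Qed.

Lemma RS_praba_meet X Y P : is_pivot_set X Y P ->
  rs_pair ([set x | eqclass x \subset X :&: Y] :|: P) =
  (lower X :&: lower Y, upper X :&: upper Y).
Proof.
case/andP=> /forall_inP hP /forall_inP hP1; congr pair; apply/setP => x.
  rewrite !inE -subsetI; apply/idP/idP => h; last first.
    apply/subsetP => y yx; rewrite !inE.
    by rewrite (eqclass_eq yx) h.
  apply/negPn/negP => nh.
  have sP : eqclass x \subset P.
    apply/subsetP => y yx; have := subsetP h y yx; rewrite !inE.
    by rewrite (eqclass_eq yx) (negPf nh).
  have px : pivot X Y x by apply: hP; apply: (subsetP sP); apply: eqclass_refl.
  have := hP1 x px; rewrite (setIidPr sP) => /cards1P[z ez].
  move: px; rewrite /pivot ez => /and3P[/negP npx].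
  case/set0Pn=> a /setIP[/set1P -> zX] /set0Pn[b /setIP[/set1P -> zY]].
  by apply: npx; rewrite sub1set inE zX.
rewrite !inE; apply/idP/andP.
  case/set0Pn=> y /setIP[yx]; rewrite !inE (eqclass_eq yx) => /orP[h|yP].
    have := subsetP h x (eqclass_refl x); rewrite inE => /andP[xX xY].
    by split; apply/set0Pn; exists x; rewrite inE eqclass_refl.
  by have := hP y yP; rewrite (pivot_eqclass _ _ yx) => /and3P[].
move=> [hX hY]; case: (boolP (eqclass x \subset X :&: Y)) => h.
  by apply/set0Pn; exists x; rewrite inE eqclass_refl !inE h.
have px : pivot X Y x by rewrite /pivot h hX.
have /cards1P[z ez] := hP1 x px.
have /setIP[zP zx] : z \in P :&: eqclass x by rewrite ez set11.
by apply/set0Pn; exists z; rewrite !inE zP orbT andbT; rewrite inE in zx.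
Qed.

Lemma rough_joinE X Y Y' : praba_run X Y Y' ->
  rough_join (RS X) (RS Y) = RS (X :|: Y').
Proof.
move=> hY; have := rough_repr_RS (RS X); have := rough_repr_RS (RS Y).
rewrite /rough_join; move: (rough_repr _) (rough_repr _) => Y1 X1 [lY uY] [lX uX].
apply: val_inj; rewrite /= (RS_praba_run hY).
by rewrite (RS_praba_run (praba_final_run _ _)) lX uX lY uY.
Qed.

Lemma rough_meetE X Y P : is_pivot_set X Y P ->
  rough_meet (RS X) (RS Y) = RS ([set x | eqclass x \subset X :&: Y] :|: P).
Proof.
move=> hP; have := rough_repr_RS (RS X); have := rough_repr_RS (RS Y).
rewrite /rough_meet; move: (rough_repr _) (rough_repr _) => Y' X' [lY uY] [lX uX].
apply: val_inj; rewrite /= (RS_praba_meet hP) RS_praba_meet ?pivot_setP //.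
by rewrite lX uX lY uY.
Qed.

Lemma rough_join_lub (a b c : rough) :
  rough_le (rough_join a b) c = rough_le a c && rough_le b c.
Proof.
rewrite -[a]rough_repr_RS -[b]rough_repr_RS (rough_joinE (praba_final_run _ _)).
have [eL eU] := RS_praba_run (praba_final_run (rough_repr a) (rough_repr b)).
rewrite /rough_le /= eL eU.
by rewrite !subUset; do 4?case: (_ \subset _).
Qed.

Lemma rough_meet_glb (a b c : rough) :
  rough_le c (rough_meet a b) = rough_le c a && rough_le c b.
Proof.
rewrite -[a]rough_repr_RS -[b]rough_repr_RS (rough_meetE (pivot_setP _ _)).
have [eL eU] := RS_praba_meet (pivot_setP (rough_repr a) (rough_repr b)).
rewrite /rough_le /= eL eU.
by rewrite !subsetI; do 4?case: (_ \subset _).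
Qed.

End Equivalence.

End RoughSets.

(* Main.v *)
(** The join of [RS X] and [RS Y] is [RS setT] iff the lower approximations of
    [X] and [Y] cover [U]. Hence the dual pseudocomplement of [RS X] is the rough
    set of the complement of [lower X], a union of classes, and the double one is
    [RS (lower X)]; these two rough sets are crisp and disjoint. *)
Require Import Defs.
From mathcomp Require Import all_boot.

Section DualPseudocomplement.

Context {U : finType} {R : rel U} (eqR : equivalence_rel R).
Implicit Types (X Y : {set U}) (a b : rough R).

Lemma lower_sub X : lower R X \subset X.
Proof.
by apply/subsetP => x; rewrite inE => /subsetP; apply; apply: eqclass_refl.
Qed.

Lemma sub_upper X : X \subset upper R X.
Proof.
apply/subsetP => x xX; rewrite inE; apply/set0Pn; exists x.
by rewrite in_setI xX andbT; apply: eqclass_refl.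
Qed.

Lemma lowerT : lower R setT = setT.
Proof. by apply/setP => x; rewrite !inE subsetT. Qed.

(** The set [lower R X] is a union of classes, so any class meeting it lies inside it. *)
Lemma upper_lower X : upper R (lower R X) = lower R X.
Proof.
apply/eqP; rewrite eqEsubset sub_upper andbT; apply/subsetP => x.
rewrite inE => /set0Pn[y]; rewrite in_setI => /andP[xy].
by rewrite !in_set (eqclass_eq eqR xy).
Qed.

Lemma lowerC X : lower R (~: X) = ~: upper R X.
Proof. by apply/setP => x; rewrite !inE negbK setI_eq0 disjoints_subset. Qed.

Lemma upperC X : upper R (~: X) = ~: lower R X.
Proof. by apply: setC_inj; rewrite -lowerC !setCK. Qed.

Lemma lower_lower X : lower R (lower R X) = lower R X.
Proof.
apply/eqP; rewrite eqEsubset lower_sub; apply/subsetP => x; rewrite !in_set => xX.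
by apply/subsetP => y xy; rewrite inE (eqclass_eq eqR xy).
Qed.

(** Neither the chosen representatives nor the deletion run affect the rough set obtained, so the
    run [praba_final] suffices to compute it. *)
Lemma val_rough_join a b :
  val (rough_join a b) =
  ((val a).1 :|: (val b).1, (val a).2 :|: (val b).2).
Proof.
rewrite -[a]rough_repr_RS -[b]rough_repr_RS.
by rewrite (rough_joinE eqR (praba_final_run _ _ _))
  [LHS](RS_praba_run eqR (praba_final_run _ _ _)).
Qed.

Lemma val_rough_meet a b :
  val (rough_meet a b) =
  ((val a).1 :&: (val b).1, (val a).2 :&: (val b).2).
Proof.
rewrite -[a]rough_repr_RS -[b]rough_repr_RS.
by rewrite (rough_meetE eqR (pivot_setP eqR _ _))
  [LHS](RS_praba_meet eqR (pivot_setP eqR _ _)).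
Qed.

Lemma rough_join_eqT X Y :
  (rough_join (RS R X) (RS R Y) == RS R setT) =
  (~: lower R X \subset lower R Y).
Proof.
rewrite -val_eqE val_rough_join /= /rs_pair lowerT xpair_eqE.
have -> : upper R setT = setT by apply/eqP; rewrite -subTset sub_upper.
have -> : (~: lower R X \subset lower R Y) = (lower R X :|: lower R Y == setT).
  by rewrite -subTset -subDset setTD.
(* Once the lower approximations cover [U], so do the upper ones, which contain them. *)
apply: andb_idr => /eqP eT; rewrite -subTset -eT.
by apply: setUSS; apply: subset_trans (lower_sub _) (sub_upper _).
Qed.

Lemma is_dual_pc_RS X : is_dual_pc (RS R X) (RS R (~: lower R X)).
Proof.
apply/andP; split; first by rewrite rough_join_eqT lowerC upper_lower.
apply/forallP => c; rewrite -[c]rough_repr_RS rough_join_eqT; apply/implyP.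
(* Both approximations of [~: lower R X] are the set itself, so [sXc] settles the lower components,
   and the upper ones since lower lies within upper. *)
move=> sXc; rewrite /rough_le /= lowerC upper_lower upperC lower_lower sXc /=.
by apply: subset_trans (sub_upper _); apply: subset_trans (lower_sub _).
Qed.

End DualPseudocomplement.

Theorem lemma2 (U : finType) (hU : 0 < #|U|) (R : rel U)
  (hR : equivalence_rel R) : dual_rough_Stone_algebra R.
Proof.
split=> a; rewrite -[a]rough_repr_RS; set X := rough_repr a.
  by exists (RS R (~: lower R X)); apply: is_dual_pc_RS.
have pcE Y := dual_pcP (is_dual_pc_RS hR Y).
(* The two complements cancel, as [~: lower R X] is its own lower approximation. *)
rewrite !pcE lowerC upper_lower // setCK.
apply: val_inj; rewrite val_rough_meet //= /rs_pair.
rewrite lowerC upperC lower_lower // upper_lower // setIC setICr.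
(* Both components of the meet have become [set0]; it remains to compute [RS R set0]. *)
congr pair; apply/esym; first by apply/eqP; rewrite -subset0 lower_sub.
by rewrite -setCT upperC lowerT.
Qed.
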